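(* Every barrelled locally convex space that is a Gâteaux Differentiability Space is a quasi-Baire space.
   Context: All vector spaces are real; all topological vector spaces are Hausdorff; ''lcs'' means locally convex space. A lcs $E$ is a Gâteaux Differentiability Space (GDS) if every continuous convex function $f:D\to\mathbb{R}$, where $D\subset E$ is a nonempty open convex set, is Gâteaux differentiable on a dense subset of $D$. Here $f$ is Gâteaux differentiable at $x\in D$ if there is $x^*\in E'$ with $\lim_{t\to 0}\frac{f(x+ty)-f(x)}{t}=x^*(y)$ for every $y\in E$. A lcs $E$ is barrelled if every $\sigma(E',E)$-bounded set in $E'$ is equicontinuous. A lcs $E$ is quasi-Baire if $E$ is barrelled and $E$ is not the union of an increasing sequence of nowhere dense linear subspaces of $E$. *)

(* Defs.v *)
From HB Require Import structures.
From mathcomp Require Import all_boot all_order all_algebra.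
From mathcomp Require Import all_classical all_reals all_analysis.

Set Implicit Arguments.
Unset Strict Implicit.
Unset Printing Implicit Defensive.

Import Order.TTheory GRing.Theory Num.Theory.
Import numFieldNormedType.Exports.

Local Open Scope classical_set_scope.
Local Open Scope ring_scope.

(* [tvsType R] is the library's class of locally convex spaces over [R]; it does
   not include separation, so [hausdorff_space E] is assumed separately. *)

Section LocallyConvexSpaces.
Context {R : realType}.
Implicit Type E : tvsType R.

Definition topological_dual E : set (E -> R^o) :=
  [set g | linear g /\ continuous g].

(* The neighbourhoods of 0 for sigma(E', E), the topology that E' inherits from
   the space of all functions E -> R with pointwise convergence. *)
Definition weak_star_nbhs0 E : set_system (E -> R^o) :=
  within (@topological_dual E) (nbhs (cst 0 : {ptws E -> R^o})).

(* Boundedness in the sense of topological vector spaces: [B] is absorbed by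
   every neighbourhood of 0. *)
Definition weak_star_bounded E (B : set (E -> R^o)) :=
  forall U : set (E -> R^o), weak_star_nbhs0 U ->
    exists2 r : R, 0 < r &
      forall s : R, r <= `|s| -> B `<=` [set (fun x => s *: g x) | g in U].

Definition barrelled E :=
  forall B : set (E -> R^o), B `<=` @topological_dual E ->
    weak_star_bounded B -> equicontinuous B id.

Definition nowhere_dense E (A : set E) := (closure A)° = set0.

Definition quasi_baire E :=
  barrelled E /\
  ~ exists L : nat -> set E,
      [/\ forall n, submod_closed [in L n],
          forall n, nowhere_dense (L n),
          forall n, L n `<=` L n.+1 &
          \bigcup_n L n = [set: E]].

(* Only the values of [f] near [x] matter, so for [x] in an open set [D] this is
   a property of the restriction of [f] to [D]. *)
Definition gateaux_differentiable E (f : E -> R^o) (x : E) :=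
  exists2 g : E -> R^o, @topological_dual E g &
    forall y : E, t^-1 *: (f (x + t *: y) - f x) @[t --> (0 : R^o)^'] --> g y.

(* A function D -> R is represented by a total function restricted to [D]. *)
Definition gateaux_differentiability_space E :=
  forall (D : set E) (f : E -> R^o),
    D !=set0 -> open D -> convex_set D ->
    {within D, continuous f} -> convex_function D f ->
    D `<=` closure (D `&` [set x | gateaux_differentiable f x]).

End LocallyConvexSpaces.

Arguments barrelled {R} E.
Arguments quasi_baire {R} E.
Arguments gateaux_differentiability_space {R} E.

(* Main.v *)
(* If E is the union of an increasing sequence of nowhere dense subspaces L n,
   Hahn-Banach gives for each n a nonzero continuous functional f n vanishing
   on L n.  At each point all but finitely many f n vanish, so
   p = \sum_n |f n| is a finite seminorm; it is the supremum of the signed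
   partial sums of the f n, hence continuous since E is barrelled.  But every x
   lies in some L n, where |f n| has a corner along any direction y with
   f n y != 0; the remaining terms being convex, they cannot smooth it out, and
   p is nowhere Gateaux differentiable. *)

Require Import Defs.
From mathcomp Require Import all_boot all_order all_algebra.
From mathcomp Require Import all_classical all_reals all_analysis.
From mathcomp Require Import lra ring.

Import Order.TTheory GRing.Theory Num.Theory.
Import numFieldNormedType.Exports.
Set Implicit Arguments.
Unset Strict Implicit.
Unset Printing Implicit Defensive.

Local Open Scope classical_set_scope.
Local Open Scope ring_scope.

(** * Sublinear functionals and the Hahn-Banach theorem *)

Section Sublinear.
Context {R : realType} {V : lmodType R}.
Implicit Types (q : V -> R) (x y : V).

(** Homogeneity is only an inequality, which is easier to verify; applying it to [t^-1] as well
    gives equality. *)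
Definition sublinear q :=
  (forall x y, q (x + y) <= q x + q y) /\
  (forall t x, 0 < t -> q (t *: x) <= t * q x).

Lemma sublinear0 q : sublinear q -> q 0 = 0.
Proof.
move=> [qD qZ]; have := qD 0 0; have := @qZ (2^-1) 0.
by rewrite scaler0 addr0 invr_gt0 ltr0n => /(_ isT); lra.
Qed.

Lemma sublinearZ q t x : sublinear q -> 0 <= t -> q (t *: x) = t * q x.
Proof.
move=> sq; rewrite le_eqVlt => /predU1P[<-|t0].
  by rewrite scale0r mul0r sublinear0.
apply/eqP; rewrite eq_le sq.2//= -ler_pdivlMl//.
have := @sq.2 t^-1 (t *: x); rewrite scalerA mulVf ?gt_eqF// scale1r.
by apply; rewrite invr_gt0.
Qed.

Lemma sublinear_geN q x : sublinear q -> - q (- x) <= q x.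
Proof.
by move=> sq; have := sq.1 x (- x); rewrite subrr sublinear0//; lra.
Qed.

(** Shared by the three infima taken below: [ray_inf], the lower bound of a chain, and the gauge. *)
Lemma sublinear_inf (S : V -> set R) :
  (forall x, S x !=set0) -> (forall x, has_lbound (S x)) ->
  (forall x y a b, S x a -> S y b -> exists2 c, S (x + y) c & c <= a + b) ->
  (forall t x a, 0 < t -> S x a -> exists2 c, S (t *: x) c & c <= t * a) ->
  sublinear (fun x => inf (S x)).
Proof.
move=> S0 Slb SD SZ; split=> [x y|t x t0].
  rewrite -lerBlDr; apply: lb_le_inf => // a Sa.
  rewrite lerBlDr -lerBlDl; apply: lb_le_inf => // b Sb.
  have [c Sc cab] := SD _ _ _ _ Sa Sb.
  by rewrite lerBlDl (le_trans _ cab)// ge_inf.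
rewrite -ler_pdivrMl//; apply: lb_le_inf => // a Sa.
have [c Sc cta] := SZ _ _ _ t0 Sa.
by rewrite ler_pdivrMl// (le_trans _ cta)// ge_inf.
Qed.

(* The greatest sublinear functional below q taking the value - q y at - y. *)
Definition ray_inf q y x :=
  inf [set q (x + t *: y) - t * q y | t in [set t | 0 <= t]].

(** Subadditivity at [x + t *: y] and [- x]; the bound makes the infimum in [ray_inf] a genuine
    one. *)
Lemma ray_inf_lbound q y x : sublinear q ->
  lbound [set q (x + t *: y) - t * q y | t in [set t | 0 <= t]] (- q (- x)).
Proof.
move=> sq _ [t /= t0 <-].
have := sq.1 (x + t *: y) (- x); rewrite addrAC subrr add0r sublinearZ//; lra.
Qed.

Lemma ray_inf_le q y x t : sublinear q -> 0 <= t ->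
  ray_inf q y x <= q (x + t *: y) - t * q y.
Proof.
move=> sq t0; apply: ge_inf; last by exists t.
by exists (- q (- x)); exact: ray_inf_lbound.
Qed.

Lemma sublinear_ray_inf q y : sublinear q -> sublinear (ray_inf q y).
Proof.
move=> sq; apply: sublinear_inf => [x|x|x z _ _ [s /= s0 <-] [t /= t0 <-]|].
- by exists (q (x + 0 *: y) - 0 * q y), 0 => /=.
- by exists (- q (- x)); exact: ray_inf_lbound.
- exists (q (x + z + (s + t) *: y) - (s + t) * q y).
    by exists (s + t) => //=; exact: addr_ge0.
  rewrite scalerDl addrACA mulrDl; have := sq.1 (x + s *: y) (z + t *: y); lra.
move=> t x _ t0 [s /= s0 <-].
exists (q (t *: x + (t * s) *: y) - t * s * q y).
  by exists (t * s) => //=; rewrite mulr_ge0// ltW.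
by rewrite -scalerA -scalerDr (sublinearZ _ sq (ltW t0)) mulrBr mulrA.
Qed.

(** Minimality forces [ray_inf q y = q] for every [y]; the term [t = 1] then gives
    [q x + q y <= q (x + y)]. So [q] is additive, hence odd, and homogeneity extends to negative
    scalars. *)
Lemma minimal_sublinear_linear q : sublinear q ->
  (forall p, sublinear p -> (forall x, p x <= q x) -> p = q) ->
  linear (q : V -> R^o).
Proof.
move=> sq qmin.
have qD x y : q (x + y) = q x + q y.
  apply/eqP; rewrite eq_le sq.1/=.
  have rq : ray_inf q y = q.
    apply: qmin => [|z]; first exact: sublinear_ray_inf.
    have := ray_inf_le y z sq (lexx 0).
    by rewrite scale0r addr0 mul0r subr0.
  have := ray_inf_le y x sq ler01.
  by rewrite rq scale1r mul1r lerBrDr.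
have qN x : q (- x) = - q x.
  by apply/eqP; rewrite -addr_eq0 -qD addNr sublinear0.
move=> a x y; rewrite qD; congr (_ + _).
have [a0|a0] := leP 0 a; first exact: sublinearZ.
rewrite -[a *: x]opprK -scaleNr qN sublinearZ ?oppr_ge0 1?ltW//.
by rewrite mulNr opprK.
Qed.

(* Zorn's lemma gives a minimal sublinear functional below ray_inf q x; it is
   linear, and at least q x at x because ray_inf q x (- x) <= - q x. *)
Theorem hahn_banach q x : sublinear q ->
  exists f : V -> R^o, [/\ linear f, forall y, f y <= q y & f x = q x].
Proof.
move=> sq; set q0 := ray_inf q x.
have sq0 : sublinear q0 by exact: sublinear_ray_inf.
pose T := {p : V -> R | sublinear p /\ forall y, p y <= q0 y}.
(* The order is reversed, so that a maximal element is a minimal functional. *)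
pose geT (p p' : T) := `[< forall y, sval p' y <= sval p y >].
have [p pmin] : exists p, forall p', geT p p' -> p' = p.
  apply: Zorn => [p|p p' p'' /asboolP pp' /asboolP p'p''|[p Pp] [p' Pp']|A Atot].
  - by apply/asboolP.
  - by apply/asboolP => y; exact: le_trans (pp' y).
  - move=> /asboolP /= pp' /asboolP /= p'p; apply/eq_exist/funext => y.
    by apply/eqP; rewrite eq_le p'p pp'.
  have [->|/set0P[p0 Ap0]] := eqVneq A set0.
    by exists (exist _ q0 (conj sq0 (fun y => lexx (q0 y)))).
  pose S y := [set sval p y | p in A].
  have Slb y : lbound (S y) (- q0 (- y)).
    move=> _ [p _ <-]; have [sp pq0] := svalP p.
    by rewrite (le_trans _ (sublinear_geN y sp))// lerN2.
  have sS : sublinear (fun y => inf (S y)).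
    apply: sublinear_inf
      => [y|y|y z _ _ [p Ap <-] [p' Ap' <-]|t y _ t0 [p Ap <-]].
    - by exists (sval p0 y), p0.
    - by exists (- q0 (- y)).
    (* Of two members of the chain, the smaller one serves for both summands. *)
    - have [/asboolP pp'|/asboolP pp'] := Atot _ _ Ap Ap'.
        exists (sval p' (y + z)); first by exists p'.
        by rewrite (le_trans ((svalP p').1.1 y z))// lerD2r.
      exists (sval p (y + z)); first by exists p.
      by rewrite (le_trans ((svalP p).1.1 y z))// lerD2l.
    exists (sval p (t *: y)); first by exists p.
    exact: (svalP p).1.2.
  have Sle y p : A p -> inf (S y) <= sval p y.
    by move=> Ap; apply: ge_inf; [exists (- q0 (- y)) | exists p].
  have Sq0 y : inf (S y) <= q0 y.
    exact: le_trans (Sle y _ Ap0) ((svalP p0).2 y).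
  pose m : T := exist _ (fun y => inf (S y)) (conj sS Sq0).
  by exists m => p Ap; apply/asboolP => y; exact: Sle.
have [sp pq0] := svalP p.
have q0q y : q0 y <= q y.
  by have := ray_inf_le x y sq (lexx 0); rewrite scale0r addr0 mul0r subr0.
have linp : linear (sval p : V -> R^o).
  apply: minimal_sublinear_linear => // p' sp' p'p.
  have p'q0 y : p' y <= q0 y by exact: le_trans (pq0 y).
  pose m : T := exist _ p' (conj sp' p'q0).
  by have /(congr1 sval) := pmin m (asboolT p'p).
exists (sval p); split=> // [y|]; first exact: le_trans (q0q y).
apply/eqP; rewrite eq_le (le_trans (pq0 x))//=.
have /= := ray_inf_le x (- x) sq ler01.
rewrite scale1r addNr sublinear0// sub0r mul1r => q0Nx.
rewrite -lerN2 (le_trans _ q0Nx)// (le_trans _ (pq0 _))//.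
have := linp (-1) x 0; rewrite !addr0 scaleN1r => ->.
by rewrite sublinear0// addr0 scaleN1r.
Qed.

End Sublinear.

Lemma convex_set_combination (R : realType) (V : lmodType R) (U : set V) (t : R) x y :
  convex_set U -> 0 <= t -> t <= 1 -> U x -> U y -> U (t *: x + (1 - t) *: y).
Proof.
move=> cU t0 t1 Ux Uy.
by have /set_mem := cU x y (Itv01 t0 t1) (mem_set Ux) (mem_set Uy).
Qed.

Lemma linear_sublinear (R : realType) (V : lmodType R) (f : V -> R^o) :
  linear f -> sublinear f.
Proof.
move=> flin; have f0 : f 0 = 0.
  have /(congr1 (fun z => z - f 0)) := flin 1 0 0.
  by rewrite !scale1r addr0 addrK subrr.
split=> [x y|t x _]; first by have := flin 1 x y; rewrite !scale1r => ->.
by have := flin t x 0; rewrite !addr0 f0 addr0 => ->.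
Qed.

(** * Continuity, gauges and separation in locally convex spaces *)

Section LocallyConvex.
Context {R : realType} {E : tvsType R}.

(** On [e / 2] times the intersection of [U] and [- U], both [q v] and [q (- v)] are at most
    [e / 2]; subadditivity then bounds the change of [q] at [x] from both sides. *)
Lemma sublinear_continuous (q : E -> R^o) (U : set E) :
  sublinear q -> nbhs 0 U -> (forall x, U x -> q x <= 1) -> continuous q.
Proof.
move=> sq U0 qU x; apply/cvgrPdist_lt => e e0.
have e2 : 0 < e / 2 by rewrite divr_gt0.
have e20 : e / 2 != 0 by rewrite gt_eqF.
have UNU : nbhs 0 (U `&` -%R @` U) by apply: filterI => //; exact: nbhs0N.
apply: filterS (nbhsT x (nbhs0Z e20 UNU)) => _ [_ [u [Uu [v Uv vu]] <-] <-].
rewrite -{}vu in Uu *.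
have qv : q (e / 2 *: v) <= e / 2.
  by rewrite (sublinearZ _ sq (ltW e2)) ger_pMr// qU.
have qNv : q (e / 2 *: - v) <= e / 2.
  by rewrite (sublinearZ _ sq (ltW e2)) ger_pMr// qU.
have := sq.1 x (e / 2 *: - v); have := sq.1 (x + e / 2 *: - v) (e / 2 *: v).
rewrite -addrA -scalerDr addNr scaler0 addr0 => q1 q2.
have e2e : e / 2 < e by rewrite ltr_pdivrMr// ltr_pMr// ltr1n.
by rewrite ltr_norml; apply/andP; split; lra.
Qed.

Lemma convex_nbhs0 (U : set E) : nbhs 0 U ->
  exists2 W : set E, nbhs 0 W & convex_set W /\ W `<=` U.
Proof.
move=> U0; have [B cB [oB B0]] := @locally_convex R E.
have [W /= [BW W0] WU] := B0 0 U U0.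
exists W; first by apply: open_nbhs_nbhs; split=> //; exact: oB.
by split=> //; apply: cB; exact/mem_set.
Qed.

Lemma absorbing_nbhs0 (U : set E) x : nbhs 0 U ->
  exists2 t : R, 0 < t & U (t^-1 *: x).
Proof.
move=> U0; have /= := scale_continuous (0 : R^o, x) U.
rewrite scale0r => /(_ U0)[[A B] /= [A0 Bx] ABU].
have [e /= e0 eA] := (nbhs_ballP _ _).1 A0.
exists (e / 2)^-1; first by rewrite invr_gt0 divr_gt0.
rewrite invrK; apply: (ABU (e / 2, x)); split; last exact: nbhs_singleton.
apply: eA; rewrite -ball_normE /= sub0r normrN gtr0_norm ?divr_gt0//.
by rewrite ltr_pdivrMr// ltr_pMr// ltr1n.
Qed.

(** The Minkowski functional of [W]. *)
Definition gauge (W : set E) x := inf [set t : R | 0 < t /\ W (t^-1 *: x)].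

Lemma gauge_le W t x : 0 < t -> W (t^-1 *: x) -> gauge W x <= t.
Proof.
by move=> t0 Wtx; apply: ge_inf => //; exists 0 => s [/ltW].
Qed.

Lemma sublinear_gauge W :
  (forall t x y, 0 <= t -> t <= 1 -> W x -> W y -> W (t *: x + (1 - t) *: y)) ->
  (forall x, exists2 t : R, 0 < t & W (t^-1 *: x)) ->
  sublinear (gauge W).
Proof.
move=> cW aW; apply: sublinear_inf
  => [x|x|x y a b [a0 Wa] [b0 Wb]|t x a t0 [a0 Wa]].
- by have [t t0 Wt] := aW x; exists t.
- by exists 0 => s [/ltW].
- exists (a + b) => //; split; first exact: addr_gt0.
  have ab0 : a + b != 0 by rewrite gt_eqF// addr_gt0.
  (* A convex combination of the two given points of [W], with weights proportional to [a] and
     [b]. *)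
  suff -> : (a + b)^-1 *: (x + y) =
      (a / (a + b)) *: (a^-1 *: x) + (1 - a / (a + b)) *: (b^-1 *: y).
    apply: cW => //; first by rewrite divr_ge0// ?addr_ge0// ltW.
    by rewrite ler_pdivrMr ?addr_gt0// mul1r lerDl ltW.
  rewrite scalerDr !scalerA; congr (_ *: _ + _ *: _); field; first lra.
  by rewrite ab0 gt_eqF.
exists (t * a) => //; split; first exact: mulr_gt0.
by rewrite scalerA invfM mulrAC mulVf ?gt_eqF// mul1r.
Qed.

(** Take a convex neighbourhood [U] of 0 such that [x - U] misses [L], and apply Hahn-Banach at [x]
    to the gauge of [W = L + U]. This gauge is at most 1 on [U], below every positive number on [L],
    and at least 1 at [x]. *)
Lemma subspace_separation (L : set E) x :
  submod_closed [in L] -> ~ closure L x ->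
  exists f : E -> R^o,
    [/\ topological_dual f, forall y, L y -> f y = 0 & f x != 0].
Proof.
move=> [/set_mem L0 Llin] /existsNP[B /not_implyP[Bx LB]].
have LZ t y : L y -> L (t *: y).
  move=> Ly; have := Llin t y 0 (mem_set Ly) (mem_set L0).
  by rewrite addr0 => /set_mem.
have LD y z : L y -> L z -> L (y + z).
  move=> Ly Lz; have := Llin 1 y z (mem_set Ly) (mem_set Lz).
  by rewrite scale1r => /set_mem.
have := nbhsB (- x) Bx; rewrite addNr => /nbhs0N/convex_nbhs0[U U0 [cU UB]].
have LU u : U u -> ~ L (x - u).
  move=> /UB[_ [b Bb <-] <-]; rewrite opprK addrA subrr add0r => Lb.
  by apply: LB; exists b.
pose W := [set w | exists2 l, L l & U (w - l)].
have UW : U `<=` W by move=> u Uu; exists 0; rewrite ?subr0.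
have sW : sublinear (gauge W).
  apply: sublinear_gauge => [t y z t0 t1 [l Ll Uyl] [m Lm Uzm]|y].
    exists (t *: l + (1 - t) *: m); first by apply: LD; exact: LZ.
    by rewrite opprD addrACA -!scalerBr; exact: convex_set_combination.
  by have [t t0 /UW Wt] := absorbing_nbhs0 y U0; exists t.
have [f [flin fW fx]] := hahn_banach x sW.
have fL y : L y -> f y <= 0.
  move=> Ly; rewrite leNgt; apply/negP => fy0.
  have fy20 : 0 < f y / 2 by rewrite divr_gt0.
  have : f y <= f y / 2.
    apply: le_trans (fW y) _; apply: gauge_le => //.
    exists ((f y / 2)^-1 *: y); first exact: LZ.
    by rewrite subrr; exact: nbhs_singleton.
  lra.
have sf := linear_sublinear flin.
exists f; split.
- split=> //; apply: (sublinear_continuous sf U0) => u Uu.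
  apply: le_trans (fW u) _; apply: gauge_le => //.
  by rewrite invr1 scale1r; exact: UW.
- move=> y Ly; apply/eqP; rewrite eq_le fL//=.
  rewrite (le_trans _ (sublinear_geN _ sf))// oppr_ge0 fL//.
  by rewrite -scaleN1r; exact: LZ.
rewrite gt_eqF// fx (lt_le_trans ltr01)//; apply: lb_le_inf.
  by have [t t0 /UW Wt] := absorbing_nbhs0 x U0; exists t.
(* If [t < 1], convexity of [U] with 0 puts [x - t *: l] in [U], although subtracting it from [x]
   leaves [t *: l], a point of [L]. *)
move=> t [t0 [l Ll Uxl]]; rewrite leNgt; apply/negP => t1.
apply: (LU (x - t *: l)); last by rewrite subKr; exact: LZ.
have := convex_set_combination cU (ltW t0) (ltW t1) Uxl (nbhs_singleton U0).
by rewrite scaler0 addr0 scalerBr scalerA divff ?gt_eqF// scale1r.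
Qed.

End LocallyConvex.

(** * Weak-star bounded sets of functionals *)

Section WeakStar.
Context {R : realType} {E : tvsType R}.

Lemma topological_dual_sum (f : nat -> E -> R^o) (s : nat -> R) m :
  (forall i, topological_dual (f i)) ->
  topological_dual (fun x => \sum_(0 <= i < m) s i * f i x : R^o).
Proof.
move=> df; split=> [a x y|x].
  rewrite scaler_sumr -big_split; apply: eq_bigr => i _.
  by rewrite (df i).1 mulrDr -[LHS]/(s i * (a * f i x) + _) mulrCA.
apply: cvg_big => [|i _]; first exact: add_continuous.
by apply: cvgMl_tmp; exact: (df i).2.
Qed.

Lemma pointwise_bounded_weak_star_bounded (B : set (E -> R^o)) (p : E -> R) :
  B `<=` @topological_dual R E -> (forall g x, B g -> `|g x| <= p x) ->
  weak_star_bounded B.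
Proof.
move=> Bdual Bp U U0.
(* [F] consists of the sets containing [s^-1 *: B] for all large [s]. Absorption of [B] thus becomes
   convergence of [F] to 0, which is checked pointwise. *)
pose F : set_system (E -> R^o) := [set V | exists2 r : R, 0 < r &
  forall s, r <= `|s| -> forall g, B g -> V (fun x => s^-1 *: g x)].
have FF : Filter F.
  split=> [|V W [r r0 rV] [r' r'0 r'W]|V W VW [r r0 rV]].
  - by exists 1.
  - exists (r + r') => [|s rs g Bg]; first exact: addr_gt0.
    by split; [apply: rV|apply: r'W] => //; apply: le_trans rs;
      rewrite ?lerDl ?lerDr ltW.
  - by exists r => // s rs g Bg; apply/VW/rV.
have : {ptws, F --> (cst 0 : E -> R^o)}.
  apply/pointwise_cvgP => x; apply/cvgrPdist_lt => e e0.
  have r0 : 0 < (`|p x| + 1) / e by rewrite divr_gt0// ltr_wpDl.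
  exists ((`|p x| + 1) / e) => // s rs g Bg /=.
  have s0 : 0 < `|s| by exact: lt_le_trans rs.
  rewrite sub0r normrN normrM normfV mulrC ltr_pdivrMr//.
  rewrite ler_pdivrMr// mulrC in rs; apply: lt_le_trans rs.
  by rewrite (le_lt_trans (Bp _ _ Bg))// (le_lt_trans (ler_norm _))// ltrDl.
move=> /(_ _ U0)[r r0 rU]; exists r => // s rs g Bg /=.
have s0 : s != 0 by rewrite -normr_gt0 (lt_le_trans r0).
exists (fun x => s^-1 *: g x); last first.
  by apply/funext => x; rewrite scalerA divff// scale1r.
(* [U] is a neighbourhood only within the dual, so the rescaled [g] must be shown to lie there. *)
apply: (rU s rs g Bg); have [glin gcont] := Bdual _ Bg; split=> [a x y|x].
  by rewrite glin scalerDr !scalerA mulrC.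
by apply: cvgZl_tmp; exact: gcont.
Qed.

End WeakStar.

(** * The seminorm built from the functionals: continuity and corners *)

Section SumOfFunctionals.
Context {R : realType} {E : tvsType R}.
Variables (f : nat -> E -> R^o) (N : E -> nat).
Hypothesis df : forall i, topological_dual (f i).
Hypothesis fN : forall x n, (N x <= n)%N -> f n x = 0.

Definition abs_sum : E -> R^o := fun x => \sum_(0 <= i < N x) `|f i x|.

(** The cut-off [N x] varies with the point; a common range [m] allows termwise comparison of
    several values. *)
Lemma abs_sumE x m : (N x <= m)%N -> abs_sum x = \sum_(0 <= i < m) `|f i x|.
Proof.
move=> Nm; rewrite [RHS](@big_cat_nat _ _ _ (N x))//= [X in _ + X]big_nat_cond.
by rewrite [X in _ + X]big1 ?addr0// => i /andP[/andP[/fN-> _] _]; rewrite normr0.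
Qed.

Lemma sublinear_abs_sum : sublinear abs_sum.
Proof.
split=> [x y|t x t0].
  set m := maxn (N (x + y)) (maxn (N x) (N y)).
  rewrite !(@abs_sumE _ m) ?leq_max ?leqnn ?orbT// -big_split ler_sum// => i _.
  by have := (df i).1 1 x y; rewrite !scale1r => ->; exact: ler_normD.
set m := maxn (N (t *: x)) (N x).
rewrite !(@abs_sumE _ m) ?leq_max ?leqnn ?orbT// mulr_sumr ler_sum// => i _.
by rewrite (sublinearZ _ (linear_sublinear (df i).1) (ltW t0)) normrM gtr0_norm.
Qed.

Lemma abs_sum_ge x s m : (forall i, `|s i| <= 1) ->
  `|\sum_(0 <= i < m) s i * f i x| <= abs_sum x.
Proof.
move=> s1; rewrite (@abs_sumE _ (maxn (N x) m)) ?leq_maxl//.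
apply: le_trans (ler_norm_sum _ _ _) _.
rewrite [leRHS](@big_cat_nat _ _ _ m) ?leq_maxr//=.
rewrite -[leLHS]addr0 lerD ?sumr_ge0// ler_sum// => i _.
by rewrite normrM ler_piMl.
Qed.

Lemma abs_sum_continuous : barrelled E -> continuous abs_sum.
Proof.
move=> bE.
(* Coefficients in [[-1, 1]] rather than only 1 and -1, because the sign of [f i x] used below may
   be 0. *)
pose B : set (E -> R^o) := [set g | exists (s : nat -> R) m,
  (forall i, `|s i| <= 1) /\ g = fun x => \sum_(0 <= i < m) s i * f i x].
have Bdual : B `<=` @topological_dual R E.
  by move=> _ [s [m [_ ->]]]; exact: topological_dual_sum.
have Bbounded : weak_star_bounded B.
  apply: (@pointwise_bounded_weak_star_bounded _ _ _ abs_sum) => //.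
  by move=> _ x [s [m [s1 ->]]]; exact: abs_sum_ge.
have nB := bE B Bdual Bbounded 0 _ (entourage_ball R^o (PosNum ltr01)).
apply: (sublinear_continuous sublinear_abs_sum nB) => x /= xB.
(* With the signs taken at [x] itself, this member of [B] attains [abs_sum x] at [x]. *)
have Bg : B (fun y => \sum_(0 <= i < N x) Num.sg (f i x) * f i y).
  exists (fun i => Num.sg (f i x)), (N x); split=> // i.
  by rewrite normr_sg lern1 leq_b1.
have := xB _ Bg.
rewrite /= -ball_normE /= big1 => [|i _].
  rewrite sub0r normrN => /ltW; apply: le_trans.
  apply: le_trans (ler_norm _).
  by apply: ler_sum => i _; rewrite -normrEsg.
by rewrite (sublinear0 (linear_sublinear (df i).1)) mulr0.
Qed.

(** Every [|f i|] is convex, so its second difference is nonnegative; that of [|f n|] equals the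
    left-hand side because [f n x = 0]. *)
Lemma abs_sum_second_difference n x z : f n x = 0 ->
  2 * `|f n z| <= abs_sum (x + z) + abs_sum (x - z) - 2 * abs_sum x.
Proof.
(* [n.+1] ensures that the term of index [n] is in the range. *)
move=> fnx; set m := maxn n.+1 (maxn (N x) (maxn (N (x + z)) (N (x - z)))).
rewrite !(@abs_sumE _ m) ?leq_max ?leqnn ?orbT//.
rewrite mulr_sumr -big_split -sumrB /=.
have fD i y : f i (x + y) = f i x + f i y.
  by have := (df i).1 1 x y; rewrite !scale1r.
have fopp i y : f i (- y) = - f i y.
  have := (df i).1 (-1) y 0; rewrite !addr0 !scaleN1r.
  by rewrite (sublinear0 (linear_sublinear (df i).1)) addr0.
have nm : n \in index_iota 0 m by rewrite mem_index_iota leq_max ltnS leqnn.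
rewrite (bigD1_seq n) ?iota_uniq//= !fD fopp fnx !add0r normrN normr0 mulr0 subr0.
rewrite [leLHS]mulr_natl mulr2n lerDl sumr_ge0// => i _.
rewrite !fD fopp subr_ge0 mulr_natl mulr2n.
have := ler_normD (f i x + f i z) (f i x - f i z).
by rewrite addrACA subrr addr0 -mulr2n normrMn mulr2n.
Qed.

(** Near 0, the quotients at [e / 2] and [- (e / 2)] would both be within [|f n y|] of [g y]. Their
    difference is the second difference divided by [e / 2], hence at least [2 * |f n y|]. *)
Lemma abs_sum_not_gateaux n x y : f n x = 0 -> f n y != 0 ->
  ~ gateaux_differentiable abs_sum x.
Proof.
move=> fnx fny [g _ /(_ y)/cvgrPdist_lt/(_ `|f n y|)].
rewrite normr_gt0 => /(_ fny)/nbhs_ballP[e /= e0 He].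
have e2 : 0 < e / 2 by rewrite divr_gt0.
have e2e : e / 2 < e by rewrite ltr_pdivrMr// ltr_pMr// ltr1n.
have := He (e / 2); have := He (- (e / 2)).
rewrite -!ball_normE /= !sub0r !normrN gtr0_norm//.
rewrite oppr_eq0 gt_eqF// => /(_ e2e isT) + /(_ e2e isT).
have := abs_sum_second_difference ((e / 2) *: y) fnx.
have -> : f n (e / 2 *: y) = e / 2 * f n y.
  exact: (sublinearZ _ (linear_sublinear (df n).1) (ltW e2)).
rewrite scaleNr invrN normrM (gtr0_norm e2).
set a := abs_sum _; set b := abs_sum _; set c := abs_sum _ => abc.
rewrite !ltr_norml => /andP[_ +] /andP[+ _].
rewrite scaleNr opprK -[_ *: (b - c)]/(_ * _) -[_ *: (a - c)]/(_ * _).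
have : (e / 2)^-1 * (2 * (e / 2 * `|f n y|)) <= (e / 2)^-1 * (a + b - 2 * c).
  by rewrite ler_pM2l// invr_gt0.
rewrite mulrCA mulKf ?gt_eqF//; lra.
Qed.
End SumOfFunctionals.

Theorem corollary3p7 (R : realType) (E : tvsType R) (hE : hausdorff_space E) :
  barrelled E -> gateaux_differentiability_space E -> quasi_baire E.
Proof.
move=> bE gE; split=> // -[L [Lsub Lnd Linc LT]].
have Lle n m x : (n <= m)%N -> L n x -> L m x.
  by move=> nm; apply: (homo_leq (@subset_refl _) (@subset_trans _) Linc nm).
have /choice[f /all_and3[df fL fn0]] : forall n, exists f : E -> R^o,
    [/\ topological_dual f, forall x, L n x -> f x = 0 & exists y, f y != 0].
  (* A dense [L n] would have a closure with nonempty interior, so some point lies outside the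
     closure and can be separated. *)
  move=> n; have /existsNP[x nLx] : ~ forall x, closure (L n) x.
    move=> clL; have := Lnd n; rewrite /nowhere_dense.
    have -> : closure (L n) = setT by apply/seteqP; split.
    by rewrite interiorT => /seteqP[/(_ (0 : E) I)].
  have [f [df fL fx]] := subspace_separation (Lsub n) nLx.
  by exists f; split=> //; exists x.
have /choice[N LN] : forall x, exists n, L n x.
  by move=> x; have [n _ Lnx] : (\bigcup_n L n) x by [rewrite LT]; exists n.
have fN x n : (N x <= n)%N -> f n x = 0.
  by move=> Nn; apply: fL; exact: Lle (LN x).
have sp := sublinear_abs_sum df fN.
(* Density is tested on the whole space, at the single point 0: the closure will turn out to be
   empty. *)
have /(_ 0 I) : [set: E] `<=`
    closure ([set: E] `&` [set x | gateaux_differentiable (abs_sum f N) x]).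
  apply: gE => //.
  - by exists 0.
  - exact: openT.
  - by apply: continuous_subspaceT; exact: abs_sum_continuous.
  - move=> t x y _ _; apply: le_trans (sp.1 _ _) _.
    by rewrite !(sublinearZ _ sp) // subr_ge0 le1.
rewrite (_ : _ `&` _ = set0) ?closure0// -subset0 => x [_].
(* The functional of index [N x] vanishes at [x] but not identically, so it creates a corner
   there. *)
have [y fy] := fn0 (N x).
by apply: (abs_sum_not_gateaux df fN _ fy); exact: fN.
Qed.
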